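(* The category $\textbf{S-FRM}$ of spatial frames and frame homomorphisms is dually equivalent to the category $\textbf{SFuzzy-Top}$ of sober fuzzy topological spaces and fuzzy continuous maps.
   Context: A fuzzy topological space $(S,\tau_S)$ is a set $S$ with a family $\tau_S$ of maps $S\to[0,1]$ (fuzzy open sets) containing the constant maps $0$ and $1$ and closed under finite pointwise minima and arbitrary pointwise suprema. A map $f:S\to S'$ between fuzzy topological spaces is fuzzy continuous if $g\circ f\in\tau_S$ for every $g\in\tau_{S'}$. A frame is a poset with finite meets and arbitrary joins in which finite meets distribute over arbitrary joins; a frame homomorphism preserves finite meets and arbitrary joins. For a frame $F$, $\mathit{PT}F$ denotes the set of frame homomorphisms $h:F\to[0,1]$, equipped with the fuzzy topology $\{\Psi(a):a\in F\}$ where $\Psi(a)(h)=h(a)$; a frame homomorphism $f:F\to F'$ induces $\mathit{PT}(f):\mathit{PT}F'\to\mathit{PT}F$, $h\mapsto h\circ f$. For a fuzzy topological space $S$, $\mathcal{P}(S)=\tau_S$ (a frame), and a fuzzy continuous $\eta:S_1\to S_2$ induces $\mathcal{P}(\eta):\mathcal{P}(S_2)\to\mathcal{P}(S_1)$, $\xi\mapsto\xi\circ\eta$. A frame $F$ is spatial if it is isomorphic to $\mathcal{P}(S)$ for some fuzzy topological space $S$. A fuzzy topological space $(S,\tau)$ is sober if the map $S\to\mathit{PT}\tau$, $s\mapsto(\tilde\phi\mapsto\tilde\phi(s))$, is bijective. *)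

(* Defs.v *)
From HB Require Import structures.
From mathcomp Require Import all_boot all_order all_algebra.
From mathcomp Require Import interval_inference.
From mathcomp Require Import boolp classical_sets reals.

Set Implicit Arguments.
Unset Strict Implicit.
Unset Printing Implicit Defensive.

Import Order.TTheory GRing.Theory Num.Theory.
Import FunOrder.Exports.

Local Open Scope classical_set_scope.
Local Open Scope ring_scope.

Record category := Category {
  obj :> Type;
  hom : obj -> obj -> Type;
  idm : forall x, hom x x;
  comp : forall x y z, hom y z -> hom x y -> hom x z;
  comp1m : forall x y (f : hom x y), comp (idm y) f = f;
  compm1 : forall x y (f : hom x y), comp f (idm x) = f;
  compA : forall x y z t (f : hom z t) (g : hom y z) (h : hom x y),
    comp f (comp g h) = comp (comp f g) h }.

Arguments hom {c} x y.
Arguments idm {c} x.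
Arguments comp {c x y z} f g.

Definition opposite (C : category) : category :=
  @Category C (fun x y => @hom C y x) (@idm C) (fun x y z f g => comp g f)
    (fun x y f => compm1 f) (fun x y f => comp1m f)
    (fun x y z t f g h => esym (compA h g f)).

Definition full_subcategory (C : category) (P : C -> Prop) : category :=
  @Category {x : C | P x} (fun x y => hom (sval x) (sval y))
    (fun x => idm (sval x)) (fun x y z f g => comp f g)
    (fun x y f => comp1m f) (fun x y f => compm1 f)
    (fun x y z t f g h => compA f g h).

Definition is_iso (C : category) (x y : C) (f : hom x y) : Prop :=
  exists g : hom y x, comp g f = idm x /\ comp f g = idm y.

Definition isomorphic (C : category) (x y : C) : Prop :=
  exists f : hom x y, is_iso f.

Record functor (C D : category) := Functor {
  fobj :> C -> D;
  fmap : forall x y, hom x y -> hom (fobj x) (fobj y);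
  fmap1 : forall x, fmap (idm x) = idm (fobj x);
  fmapM : forall x y z (f : hom y z) (g : hom x y),
    fmap (comp f g) = comp (fmap f) (fmap g) }.

Arguments fmap {C D} _ {x y} _.

Definition functor_id (C : category) : functor C C :=
  @Functor C C id (fun x y f => f) (fun x => erefl) (fun x y z f g => erefl).

Section FunctorComp.
Variables (C D E : category) (G : functor D E) (F : functor C D).

Let fmap1_comp x : fmap G (fmap F (idm x)) = idm (G (F x)).
Proof. by rewrite !fmap1. Qed.

Let fmapM_comp x y z (f : hom y z) (g : hom x y) :
  fmap G (fmap F (comp f g)) = comp (fmap G (fmap F f)) (fmap G (fmap F g)).
Proof. by rewrite !fmapM. Qed.

Definition functor_comp : functor C E :=
  @Functor C E (fun x => G (F x)) (fun x y f => fmap G (fmap F f))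
    fmap1_comp fmapM_comp.

End FunctorComp.

Definition naturally_isomorphic (C D : category) (F G : functor C D) : Prop :=
  exists a : forall x, hom (F x) (G x),
    (forall x y (f : hom x y), comp (a y) (fmap F f) = comp (fmap G f) (a x)) /\
    (forall x, is_iso (a x)).

Definition equivalent (C D : category) : Prop :=
  exists (F : functor C D) (G : functor D C),
    naturally_isomorphic (functor_comp G F) (functor_id C) /\
    naturally_isomorphic (functor_comp F G) (functor_id D).

Definition dually_equivalent (C D : category) : Prop :=
  equivalent (opposite C) D.

HB.mixin Record isFrame d T of Order.TMeetSemilattice d T := {
  fjoin : set T -> T;
  fjoin_supremum : forall A, supremums A (fjoin A);
  meet_fjoin : forall (x : T) (A : set T),
    Order.meet x (fjoin A) = fjoin [set Order.meet x y | y in A] }.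

#[short(type="frameType")]
HB.structure Definition Frame d :=
  { T of Order.TMeetSemilattice d T & isFrame d T }.

Record frameHom d d' (F : frameType d) (F' : frameType d') := FrameHom {
  frameHom_fun :> F -> F';
  frameHom_top : frameHom_fun Order.top = Order.top;
  frameHom_meet : forall x y,
    frameHom_fun (Order.meet x y) =
      Order.meet (frameHom_fun x) (frameHom_fun y);
  frameHom_join : forall A : set F,
    frameHom_fun (fjoin A) = fjoin (frameHom_fun @` A) }.

Lemma frameHom_eq d d' (F : frameType d) (F' : frameType d')
  (f g : frameHom F F') : f =1 g -> f = g.
Proof.
case: f g => [f f1 f2 f3] [g g1 g2 g3] /= /funext fg; subst g.
by congr FrameHom; exact: Prop_irrelevance.
Qed.

Definition frameHom_id d (F : frameType d) : frameHom F F.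
Proof. by apply: (@FrameHom _ _ F F id) => // A; rewrite image_id. Defined.

Definition frameHom_comp d1 d2 d3 (F1 : frameType d1) (F2 : frameType d2)
  (F3 : frameType d3) (g : frameHom F2 F3) (f : frameHom F1 F2) :
  frameHom F1 F3.
Proof.
apply: (@FrameHom _ _ F1 F3 (g \o f)) => [|x y|A] /=.
- by rewrite !frameHom_top.
- by rewrite !frameHom_meet.
- by rewrite !frameHom_join image_comp.
Defined.

(* The display of an ordered type carries no mathematical content, so every
   frame occurs, up to that label, among the frames with this display. *)
Fact frame_display : Order.disp_t. Proof. exact: Order.Disp tt tt. Qed.

Definition FRM : category.
Proof.
apply: (@Category (frameType frame_display) (fun F F' => frameHom F F')
  (fun F => frameHom_id F) (fun F1 F2 F3 g f => frameHom_comp g f)) => *;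
  exact: frameHom_eq.
Defined.

Section UnitInterval.
Variable R : realType.
Implicit Types (x y : {i01 R}) (A : set {i01 R}).

Let nums A : set R := [set x%:num | x in A].

Let nums_ub A : ubound (nums A) 1.
Proof. by move=> _ [x _ <-]. Qed.

Let sup_nums_ge0 A : 0 <= sup (nums A).
Proof.
have [->|/set0P[x Ax]] := eqVneq A set0; first by rewrite /nums image_set0 sup0.
apply: (@le_trans _ _ x%:num) => //.
by apply: ub_le_sup; [exists 1; exact: nums_ub|exists x].
Qed.

Let sup_nums_le1 A : sup (nums A) <= 1.
Proof.
have [->|/set0P[x Ax]] := eqVneq A set0; first by rewrite /nums image_set0 sup0.
by apply: ge_sup; [exists x%:num, x|exact: nums_ub].
Qed.

(* The real supremum; as [sup set0 = 0] in the library, the empty family is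
   sent to the least element of [0, 1], as it should be. *)
Definition sup01 A : {i01 R} :=
  Itv01 (sup_nums_ge0 A) (sup_nums_le1 A).

Lemma sup01_supremum A : supremums A (sup01 A).
Proof.
split=> [x Ax|y yA].
  rewrite -num_le /=.
  by apply: ub_le_sup; [exists 1; exact: nums_ub|exists x].
rewrite -num_le /=.
have [->|/set0P[x Ax]] := eqVneq A set0; first by rewrite /nums image_set0 sup0.
apply: ge_sup; first by exists x%:num, x.
by move=> _ [z Az <-]; rewrite num_le; exact: yA.
Qed.

Let le_i01_1 x : (x <= 1%:i01)%O.
Proof. by rewrite -num_le /=. Qed.

HB.instance Definition _ := Order.hasTop.Build ring_display {i01 R} le_i01_1.

Let meet_sup01 x A :
  Order.meet x (sup01 A) = sup01 [set Order.meet x y | y in A].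
Proof.
have [ubA leA] := sup01_supremum A.
have [ubB leB] := sup01_supremum [set Order.meet x y | y in A].
apply/eqP; rewrite eq_le; apply/andP; split; last first.
  by apply: leB => _ [y Ay <-]; rewrite leI2// ubA.
rewrite leNgt; apply/negP; rewrite ltxI => /andP[ltx ltA].
apply/negP: ltA; rewrite -leNgt; apply: leA => y Ay.
have : (Order.meet x y <= sup01 [set Order.meet x y | y in A])%O.
  by apply: ubB; exists y.
by rewrite meetEtotal ge_min !leNgt ltx.
Qed.

HB.instance Definition _ := isFrame.Build ring_display {i01 R}
  sup01_supremum meet_sup01.

End UnitInterval.

Section Fuzzy.
Variable R : realType.

Record fuzzySpace := FuzzySpace {
  fcarrier :> Type;
  fopen : set (fcarrier -> {i01 R});
  fopen0 : fopen (fun=> 0%:i01);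
  fopen1 : fopen (fun=> 1%:i01);
  fopen_min : forall f g, fopen f -> fopen g ->
    fopen (fun s => Order.min (f s) (g s));
  fopen_sup : forall G : set (fcarrier -> {i01 R}), G `<=` fopen ->
    fopen (fun s => sup01 [set g s | g in G]) }.

Record fuzzyMap (S S' : fuzzySpace) := FuzzyMap {
  fuzzyMap_fun :> S -> S';
  fuzzyMap_continuous : forall g, fopen g -> fopen (g \o fuzzyMap_fun) }.

Lemma fuzzyMap_eq (S S' : fuzzySpace) (f g : fuzzyMap S S') : f =1 g -> f = g.
Proof.
case: f g => [f cf] [g cg] /= /funext fg; subst g.
by congr FuzzyMap; exact: Prop_irrelevance.
Qed.

Definition fuzzyMap_id (S : fuzzySpace) : fuzzyMap S S :=
  @FuzzyMap S S id (fun g og => og).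

Definition fuzzyMap_comp (S1 S2 S3 : fuzzySpace) (g : fuzzyMap S2 S3)
  (f : fuzzyMap S1 S2) : fuzzyMap S1 S3 :=
  @FuzzyMap S1 S3 (g \o f)
    (fun h oh => fuzzyMap_continuous f (fuzzyMap_continuous g oh)).

Definition FuzzyTop : category.
Proof.
apply: (@Category fuzzySpace fuzzyMap fuzzyMap_id fuzzyMap_comp) => *;
  exact: fuzzyMap_eq.
Defined.

Definition opens (S : fuzzySpace) : Type := set_type (@fopen S).

Definition mk_open (S : fuzzySpace) f (open_f : fopen f) : opens S :=
  exist (fun g => g \in @fopen S) f (mem_set open_f).

Section OpensFrame.
Variable S : fuzzySpace.

HB.instance Definition _ := SubChoice.on (opens S).
(* The pointwise order, which [FunOrder] puts on functions. *)
HB.instance Definition _ := [SubChoice_isSubPOrder of opens S by <: with frame_display].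

Lemma le_opens (f g : opens S) :
  (f <= g)%O <-> forall s, (val f s <= val g s)%O.
Proof. by split=> [/asboolP|fg]; [|apply/asboolP]. Qed.

Let opens_top : opens S := mk_open (fopen1 S).

Let le_opens_top f : (f <= opens_top)%O.
Proof. by apply/le_opens => s /=; exact: lex1. Qed.

HB.instance Definition _ :=
  Order.hasTop.Build frame_display (opens S) le_opens_top.

Let opens_meet (f g : opens S) : opens S :=
  mk_open (fopen_min (set_mem (valP f)) (set_mem (valP g))).

Let le_opens_meet f g h :
  (f <= opens_meet g h)%O = (f <= g)%O && (f <= h)%O.
Proof.
apply/idP/andP => [/le_opens fgh|[/le_opens fg /le_opens fh]].
  by split; apply/le_opens => s; have := fgh s; rewrite /= le_min => /andP[].
by apply/le_opens => s; rewrite /= le_min fg fh.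
Qed.

HB.instance Definition _ :=
  Order.POrder_isMeetSemilattice.Build frame_display (opens S) le_opens_meet.

Let opens_sub (A : set (opens S)) : [set val f | f in A] `<=` @fopen S.
Proof. by move=> _ [f _ <-]; exact: set_mem (valP f). Qed.

Let opens_join (A : set (opens S)) : opens S :=
  mk_open (fopen_sup (@opens_sub A)).

Let opens_join_supremum A : supremums A (opens_join A).
Proof.
split=> [f Af|g gA]; apply/le_opens => s /=.
  by apply: (sup01_supremum _).1; exists (val f) => //; exists f.
apply: (sup01_supremum _).2 => _ [_ [f Af <-] <-].
by move: s; apply/le_opens; exact: gA.
Qed.

Let opens_meet_join (f : opens S) (A : set (opens S)) :
  Order.meet f (opens_join A) = opens_join [set Order.meet f g | g in A].
Proof.
apply/val_inj/funext => s /=.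
rewrite -meetEtotal (meet_fjoin (val f s)); congr sup01.
rewrite !image_comp; apply: eq_imagel => g Ag /=.
by rewrite meetEtotal.
Qed.

HB.instance Definition _ := isFrame.Build frame_display (opens S)
  opens_join_supremum opens_meet_join.

End OpensFrame.

Definition PT d (F : frameType d) : Type := frameHom F {i01 R}.

Definition eval_at (S : fuzzySpace) (s : S) : PT (opens S).
Proof.
apply: (@FrameHom _ _ (opens S) {i01 R} (fun phi => val phi s)) => [//|f g|A].
- by rewrite /= meetEtotal.
- by rewrite /= image_comp.
Defined.

Definition sober (S : FuzzyTop) : Prop := bijective (@eval_at S).

Definition spatial (F : FRM) : Prop :=
  exists S : fuzzySpace, isomorphic F (opens S : frameType frame_display).

Definition SFRM : category := full_subcategory spatial.

Definition SFuzzyTop : category := full_subcategory sober.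

End Fuzzy.

(* Main.v *)
(* The functors are [PT] (fuzzy points, with the opens [h |-> h a]) and
   [opens]. Every [PT F] is sober: a point [H] of its frame of opens is
   evaluation at [H \o psi], where [psi a] is the open [h |-> h a], and every
   open is some [psi a]. The unit [psi : F -> opens (PT F)] is onto by
   construction, and it is injective when [F] is spatial, since then the points
   of the underlying space already separate the elements of [F]. The counit is
   the inverse of the bijection [eval_at], which exists by sobriety. *)
Require Import Defs.
From mathcomp Require Import all_boot all_order all_algebra.
From mathcomp Require Import interval_inference.
From mathcomp Require Import boolp classical_sets reals.

Set Implicit Arguments.
Unset Strict Implicit.
Unset Printing Implicit Defensive.

Import Order.TTheory.

Local Open Scope classical_set_scope.
Local Open Scope ring_scope.

(** Evaluation naturally maps a sober space into its space of points, whereas [equivalent] asks for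
    an isomorphism from the composite functor to the identity. *)
Lemma naturally_isomorphic_sym (C D : category) (F G : functor C D) :
  naturally_isomorphic F G -> naturally_isomorphic G F.
Proof.
move=> [a [a_nat a_iso]].
have [b bK] : exists b : forall x, Defs.hom (G x) (F x), forall x,
    Defs.comp (b x) (a x) = idm (F x) /\ Defs.comp (a x) (b x) = idm (G x).
  by exists (fun x => sval (cid (a_iso x))) => x; case: cid.
exists b; split=> [x y f|x]; last first.
  by have [bKx aKx] := bK x; exists (a x).
have [bKy _] := bK y; have [_ aKx] := bK x.
(* Insert [a x] followed by its inverse on the right; naturality of [a] then brings [a y] next to
   [b y], where the two cancel. *)
rewrite -[LHS]compm1 -aKx Defs.compA -(Defs.compA (b y) (fmap G f)) -a_nat.
by rewrite Defs.compA bKy comp1m.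
Qed.

(** Since [f] is injective, each equation for [g] may be checked after applying [f], where [gK]
    reduces it to preservation by [f]. *)
Lemma frameHom_inverse d d' (F : frameType d) (F' : frameType d')
    (f : frameHom F F') (g : F' -> F) :
  cancel f g -> cancel g f -> exists g' : frameHom F' F, g' =1 g.
Proof.
move=> fK gK; have f_inj := can_inj fK.
suff [g1 gI gJ] : [/\ g Order.top = Order.top,
    forall x y, g (Order.meet x y) = Order.meet (g x) (g y) &
    forall A : set F', g (fjoin A) = fjoin (g @` A)].
  by exists (FrameHom g1 gI gJ).
split=> [|x y|A]; apply: f_inj.
- by rewrite gK frameHom_top.
- by rewrite frameHom_meet !gK.
- rewrite gK frameHom_join image_comp; congr fjoin.
  by rewrite -[LHS]image_id; apply: eq_imagel => x _ /=; rewrite gK.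
Qed.

Section FuzzyPoints.
Variable R : realType.

Section PointSpace.
Variables (d : Order.disp_t) (F : frameType d).

Definition pt_open : set (PT R F -> {i01 R}) :=
  [set g | exists a : F, g = fun h : PT R F => h a].

Lemma pt_open0 : pt_open (fun=> 0%:i01).
Proof.
(* The empty join is the bottom of [F]; each point sends it to the supremum of the empty family,
   which is 0 by the convention on [sup]. *)
exists (fjoin set0); apply/funext => h; rewrite frameHom_join image_set0.
apply/val_inj => /=.
by rewrite image_set0 sup0.
Qed.

Lemma pt_open1 : pt_open (fun=> 1%:i01).
Proof. by exists Order.top; apply/funext => h; rewrite frameHom_top. Qed.

Lemma pt_open_min f g : pt_open f -> pt_open g ->
  pt_open (fun s => Order.min (f s) (g s)).
Proof.
move=> [a ->] [b ->]; exists (Order.meet a b); apply/funext => h.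
by rewrite frameHom_meet meetEtotal.
Qed.

Lemma pt_open_sup (G : set (PT R F -> {i01 R})) : G `<=` pt_open ->
  pt_open (fun s => sup01 [set g s | g in G]).
Proof.
(* Taking every [a] whose evaluation lies in [G] avoids choosing one representative for each member
   of [G]. *)
move=> G_open; exists (fjoin [set a | G (fun h : PT R F => h a)]).
apply/funext => h; rewrite frameHom_join; congr sup01.
apply/seteqP; split=> [_ [g Gg <-]|_ [a Ga <-]].
  by have [a ga] := G_open _ Gg; exists a; rewrite /= -?ga // ga.
by exists (fun h : PT R F => h a).
Qed.

Definition pt_space : fuzzySpace R :=
  FuzzySpace pt_open0 pt_open1 pt_open_min pt_open_sup.

Lemma pt_open_eval (a : F) : @fopen R pt_space (fun h : PT R F => h a).
Proof. by exists a. Qed.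

Definition psi_fun (a : F) : opens pt_space := mk_open (pt_open_eval a).

Definition psi : frameHom F (opens pt_space).
Proof.
apply: (@FrameHom _ _ _ _ psi_fun) => [|a b|A]; apply/val_inj/funext => h /=.
- by rewrite frameHom_top.
- by rewrite frameHom_meet meetEtotal.
- by rewrite frameHom_join !image_comp.
Defined.

Lemma psi_surj (g : opens pt_space) : exists a, psi a = g.
Proof.
by have [a ga] := set_mem (valP g); exists a; apply/val_inj; rewrite ga.
Qed.

Lemma pt_space_sober : sober pt_space.
Proof.
exists (fun H => frameHom_comp H psi) => [h|H].
  exact: frameHom_eq.
by apply: frameHom_eq => g; have [a <-] := psi_surj g.
Qed.

End PointSpace.

Lemma spatial_psi_inj (F : FRM) : spatial R F -> injective (psi F).
Proof.
move=> [S [f [g [gf _]]]] a b psiab.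
have fK : cancel f g by move=> x; exact: (congr1 (fun k : frameHom _ _ => k x) gf).
apply: (can_inj fK); apply/val_inj/funext => s.
(* Each [s] in [S] yields the point [x |-> f x s] of [F]; evaluating [psi a = psi b] there gives
   [f a s = f b s]. *)
exact: (congr1 (fun k => val k (frameHom_comp (eval_at s) f)) psiab).
Qed.

Lemma spatial_psi_iso (F : FRM) : spatial R F ->
  @is_iso FRM F (opens (pt_space F) : frameType frame_display) (psi F).
Proof.
(* Surjectivity gives a section by choice, and injectivity makes it a two-sided inverse. *)
move=> /spatial_psi_inj inj; have /choice[g psiK] := @psi_surj _ F.
have gK : cancel (psi F) g by move=> a; apply: inj; rewrite psiK.
have [g' g'E] := frameHom_inverse gK psiK.
exists g'; split; apply: frameHom_eq => x.
- exact: etrans (g'E _) (gK x).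
- exact: etrans (congr1 (psi F) (g'E x)) (psiK x).
Qed.

Definition pt_map d d' (F : frameType d) (F' : frameType d')
  (f : frameHom F F') : fuzzyMap (pt_space F') (pt_space F).
Proof.
apply: (@FuzzyMap _ (pt_space F') (pt_space F) (fun h => frameHom_comp h f)).
by move=> _ [a ->]; exists (f a).
Defined.

Definition opens_map (S S' : fuzzySpace R) (f : fuzzyMap S S') :
  frameHom (opens S') (opens S).
Proof.
apply: (@FrameHom _ _ _ _
  (fun g : opens S' => mk_open (fuzzyMap_continuous f (set_mem (valP g))))).
- exact/val_inj.
- by move=> g h; exact/val_inj.
- by move=> A; apply/val_inj/funext => s /=; rewrite !image_comp.
Defined.

Lemma opens_spatial (S : fuzzySpace R) :
  spatial R (opens S : frameType frame_display).
Proof.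
exists S, (frameHom_id (opens S)), (frameHom_id (opens S)).
by split; exact: frameHom_eq.
Qed.

Definition pt_functor : functor (opposite (SFRM R)) (SFuzzyTop R).
Proof.
apply: (@Functor (opposite (SFRM R)) (SFuzzyTop R)
  (fun F => exist (@sober R) (pt_space (sval F)) (pt_space_sober (sval F)))
  (fun F F' f => pt_map f)).
- by move=> F; apply: fuzzyMap_eq => h; exact: frameHom_eq.
- by move=> F1 F2 F3 f g; apply: fuzzyMap_eq => h; exact: frameHom_eq.
Defined.

Definition opens_functor : functor (SFuzzyTop R) (opposite (SFRM R)).
Proof.
apply: (@Functor (SFuzzyTop R) (opposite (SFRM R))
  (fun S => exist (@spatial R) _ (opens_spatial (sval S)))
  (fun S S' f => opens_map f)).
- by move=> S; apply: frameHom_eq => g; exact/val_inj.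
- by move=> S1 S2 S3 f g; apply: frameHom_eq => h; exact/val_inj.
Defined.

Lemma eval_at_continuous (S : fuzzySpace R) (g : pt_space (opens S) -> {i01 R}) :
  fopen g -> fopen (g \o @eval_at R S).
(* If [g] is evaluation at the open [phi], then [g \o eval_at] is [phi] itself. *)
Proof. by move=> [phi ->]; exact: set_mem (valP phi). Qed.

Definition eval_map (S : fuzzySpace R) : fuzzyMap S (pt_space (opens S)) :=
  FuzzyMap (@eval_at_continuous S).

Lemma sober_eval_iso (S : FuzzyTop R) : sober S ->
  @is_iso (FuzzyTop R) S (pt_space (opens S)) (eval_map S).
Proof.
move=> [e evalK eK].
have e_cont (g : S -> {i01 R}) : fopen g ->
    @fopen R (pt_space (opens S)) (g \o e).
  (* As [h] is evaluation at [e h], its value at the open [g] is [g (e h)]; thus [g \o e] is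
     evaluation at [g]. *)
  move=> g_open; exists (mk_open g_open); apply/funext => h.
  by rewrite -[in RHS](eK h).
exists (@FuzzyMap R (pt_space (opens S)) S e e_cont).
by split; apply: fuzzyMap_eq => x /=; rewrite ?evalK ?eK.
Qed.

Lemma psi_natural_iso :
  naturally_isomorphic (functor_comp opens_functor pt_functor)
    (functor_id (opposite (SFRM R))).
Proof.
exists (fun F => psi (sval F)); split=> [F F' f|F].
  by apply: frameHom_eq => a; exact/val_inj.
(* Passing to the opposite category swaps the two inverse laws. *)
by have [g [gK psiK]] := spatial_psi_iso (svalP F); exists g.
Qed.

Lemma eval_natural_iso :
  naturally_isomorphic (functor_id (SFuzzyTop R))
    (functor_comp pt_functor opens_functor).
Proof.
exists (fun S => eval_map (sval S)); split=> [S S' f|S].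
  by apply: fuzzyMap_eq => s; exact: frameHom_eq.
exact: sober_eval_iso (svalP S).
Qed.

End FuzzyPoints.

Theorem theorem2p32 (R : realType) : dually_equivalent (SFRM R) (SFuzzyTop R).
Proof.
exists (pt_functor R), (opens_functor R); split; first exact: psi_natural_iso.
exact/naturally_isomorphic_sym/eval_natural_iso.
Qed.
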